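(* Let $n>p\ge 1$ be integers, let $A\in\mathbb{R}^{n\times n}$ be symmetric with eigenvalues $\lambda_1<\lambda_2<\cdots<\lambda_p<\lambda_{p+1}\le\cdots\le\lambda_n$, let $\mu>0$, and let $W=\mathrm{diag}(w_1,\dots,w_p)$ be a real diagonal matrix with $w_1>w_2>\cdots>w_p>\lambda_p/\mu$. Let $X^*$ be a global minimizer over $\mathbb{R}^{n\times p}$ of $$f_{\mu,W}(X)=\tfrac12\mathrm{tr}(X^\top AX)+\tfrac{\mu}{4}\|X^\top X-W\|_{\mathrm F}^2 ,$$ and define $$\kappa\left(\mathrm{Hess}\,f_{\mu,W}(X^* )\right)=\frac{\max_{\|Z\|_{\mathrm F}=1}\mathrm{tr}\left(Z^\top\,\mathrm{Hess}\,f_{\mu,W}(X^* )[Z]\right)}{\min_{\|Z\|_{\mathrm F}=1}\mathrm{tr}\left(Z^\top\,\mathrm{Hess}\,f_{\mu,W}(X^* )[Z]\right)},$$ where $Z$ ranges over $\mathbb{R}^{n\times p}$. Then $$\kappa\left(\mathrm{Hess}\,f_{\mu,W}(X^* )\right)=\frac{\max\left\{\lambda_n-\lambda_1,\ 2(\mu w_1-\lambda_1),\ \max_{1\le i<j\le p}\lambda_{\max}(M_{ij})\right\}}{\min\left\{\lambda_{p+1}-\lambda_p,\ 2(\mu w_p-\lambda_p),\ \min_{1\le i<j\le p}\lambda_{\min}(M_{ij})\right\}},$$ where $\lambda_{\max}(\cdot)$ and $\lambda_{\min}(\cdot)$ denote the largest and smallest eigenvalue, respectively, of the matrix $$M_{ij}=\begin{pmatrix}\mu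 w_i-\lambda_j & \sqrt{(\mu w_i-\lambda_i)(\mu w_j-\lambda_j)}\\ \sqrt{(\mu w_i-\lambda_i)(\mu w_j-\lambda_j)} & \mu w_j-\lambda_i\end{pmatrix}.$$
   Context: $\|\cdot\|_{\mathrm F}$ is the Frobenius norm. The Hessian operator of $f_{\mu,W}$ at $X\in\mathbb{R}^{n\times p}$ is the linear map on $\mathbb{R}^{n\times p}$ given by $$\mathrm{Hess}\,f_{\mu,W}(X)[Z]=AZ+\mu\left(ZX^\top X+XZ^\top X+XX^\top Z-ZW\right).$$ When $p=1$ there are no pairs $i<j$, and the terms involving $M_{ij}$ are omitted from the max and min. *)

(* Defs.v *)
From HB Require Import structures.
From mathcomp Require Import all_boot all_order all_algebra.
From mathcomp Require Import boolp classical_sets reals.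

Set Implicit Arguments.
Unset Strict Implicit.
Unset Printing Implicit Defensive.

Import Order.TTheory GRing.Theory Num.Theory.

Local Open Scope classical_set_scope.
Local Open Scope ring_scope.

(* Unlike [sup] and [inf], these are the *attained* extrema; the junk value is
   0 when the set has no greatest (resp. least) element. *)
Definition set_max (R : realType) (S : set R) : R := xget 0 (S `&` ubound S).
Definition set_min (R : realType) (S : set R) : R := xget 0 (S `&` lbound S).

Definition lambda_max (R : realType) (m : nat) (M : 'M[R]_m) : R :=
  set_max [set a | eigenvalue M a].
Definition lambda_min (R : realType) (m : nat) (M : 'M[R]_m) : R :=
  set_min [set a | eigenvalue M a].

Definition frobenius (R : realType) (m k : nat) (X : 'M[R]_(m, k)) : R :=
  Num.sqrt (\sum_(i < m) \sum_(j < k) X i j ^+ 2).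

Definition fmuW (R : realType) (n p : nat) (A : 'M[R]_n) (mu : R) (W : 'M[R]_p)
    (X : 'M[R]_(n, p)) : R :=
  1 / 2 * \tr (X^T *m A *m X) + mu / 4 * frobenius (X^T *m X - W) ^+ 2.

Definition global_minimizer (R : realType) (T : Type) (f : T -> R) (x : T) : Prop :=
  forall y : T, f x <= f y.

Definition Hess (R : realType) (n p : nat) (A : 'M[R]_n) (mu : R) (W : 'M[R]_p)
    (X Z : 'M[R]_(n, p)) : 'M[R]_(n, p) :=
  A *m Z + mu *: (Z *m X^T *m X + X *m Z^T *m X + X *m X^T *m Z - Z *m W).

Definition kappa (R : realType) (n p : nat)
    (H : 'M[R]_(n, p) -> 'M[R]_(n, p)) : R :=
  let Q := [set \tr (Z^T *m H Z) | Z in [set Z | frobenius Z = 1]] in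
  set_max Q / set_min Q.

(* The families [lam] and [w] are indexed from 1; their values at other
   indices (0, or beyond n and p respectively) are irrelevant. *)

(* The real numbers lam 1, ..., lam n are the eigenvalues of A, counted with
   multiplicity. *)
Definition spectrum (R : realType) (n : nat) (A : 'M[R]_n) (lam : nat -> R) : Prop :=
  char_poly A = \prod_(1 <= i < n.+1) ('X - (lam i)%:P).

Definition diagW (R : realType) (p : nat) (w : nat -> R) : 'M[R]_p :=
  diag_mx (\row_(j < p) w j.+1).

Definition Mpair (R : realType) (mu : R) (lam w : nat -> R) (i j : nat) : 'M[R]_2 :=
  let s := Num.sqrt ((mu * w i - lam i) * (mu * w j - lam j)) in
  block_mx (mu * w i - lam j)%:M s%:M
           s%:M                  (mu * w j - lam i)%:M : 'M[R]_(1 + 1).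

(* The maximum (resp. minimum) of c and of all F i j with 1 <= i < j <= p;
   it is c when there is no such pair. *)
Definition max_pairs (R : realType) (p : nat) (c : R) (F : nat -> nat -> R) : R :=
  \big[Num.max/c]_(ij : 'I_p * 'I_p | (ij.1 < ij.2)%N) F ij.1.+1 ij.2.+1.
Definition min_pairs (R : realType) (p : nat) (c : R) (F : nat -> nat -> R) : R :=
  \big[Num.min/c]_(ij : 'I_p * 'I_p | (ij.1 < ij.2)%N) F ij.1.+1 ij.2.+1.

(* Main.v *)
Require Import Defs.
From HB Require Import structures.
From mathcomp Require Import all_boot all_order all_algebra.
From mathcomp Require Import boolp classical_sets reals.
From mathcomp Require Import ring lra zify.

Set Implicit Arguments.
Unset Strict Implicit.
Unset Printing Implicit Defensive.

Import Order.TTheory GRing.Theory Num.Theory.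

Local Open Scope classical_set_scope.
Local Open Scope ring_scope.

(** The objective is invariant under X |-> U X for orthogonal U, provided A is
    replaced by U^T A U, and the quadratic form Z |-> tr (Z^T Hess[Z]) is then
    transported by the isometry Z |-> U Z ([fmuW_rotate], [hess_rotate]).  Since
    A is symmetric, [symmetric_orthodiag] reduces everything to the case
    A = D = diag (lam 1, ..., lam n).

    In that case the global minimizers Y are completely determined up to signs
    ([minimizer_shape]): column j of Y is c_j e_j with
    mu c_j^2 = mu w_j - lam_j.  This follows from the first and second order
    necessary conditions ([minimizer_stationary]).  Stationarity makes
    Y^T D Y + mu (Y^T Y)^2 equal to mu (Y^T Y) W; the left-hand side is
    symmetric, so Y^T Y commutes with W, whose entries are distinct, and Y^T Y
    is diagonal.  Hence every nonzero column of Y is an eigenvector of D, with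
    eigenvalue mu (w_j - |y_j|^2).  Nonnegativity of the Hessian in suitably
    chosen directions then forces each of e_1, ..., e_p to be, up to scale, a
    column of Y ([minimizer_row_neq0]), and forces them to appear in the right
    order ([minimizer_diagonal]).

    At such a point the Hessian decouples ([hess_shaped_u], [hess_shaped_d]):
    an entry Z_ij with i > p is an eigendirection with eigenvalue
    lam_i - lam_j; a diagonal entry is one with eigenvalue 2 (mu w_j - lam_j);
    and for i < j <= p the pair (Z_ij, Z_ji) sees the matrix M_ij, up to the
    sign of its off-diagonal entry, which does not affect eigenvalues.  The
    extreme values of the form on the unit sphere are therefore the extreme
    values of this list ([quad_set_max], [quad_set_min]), and monotonicity of
    lam and w picks out the extremes of the first two families. *)

(** * Orthogonal diagonalization of symmetric matrices *)

Lemma mul_trmx_col (R : comNzRingType) n (u v : 'cV[R]_n) :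
  u^T *m v = (\sum_i u i 0 * v i 0)%:M.
Proof.
by rewrite [LHS]mx11_scalar mxE; congr (_%:M); apply: eq_bigr => i _; rewrite mxE.
Qed.

(** The reflection exchanging v and e_0.  When v = e_0 the vector u below
    vanishes, and the formula still gives the identity since 2 / 0 * 0 = 0. *)
Lemma householder (R : rcfType) n (v : 'cV[R]_n.+1) :
  v^T *m v = 1%:M ->
  exists2 H : 'M[R]_n.+1, H^T *m H = 1%:M & H *m delta_mx 0 0 = v.
Proof.
move=> v1; pose e : 'cV[R]_n.+1 := delta_mx 0 0; pose u : 'cV[R]_n.+1 := v - e.
pose q := \sum_i u i 0 * u i 0.
have uu : u^T *m u = q%:M by rewrite mul_trmx_col.
have u0 : q = 0 -> u = 0.
  move=> /eqP; rewrite psumr_eq0 => [/allP h|i _]; last by rewrite -expr2 sqr_ge0.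
  apply/matrixP => i j; rewrite (ord1 j) [RHS]mxE.
  by have /(_ i (mem_index_enum _)) := h; rewrite mulf_eq0 orbb => /eqP.
pose P := u *m u^T.
have PT : P^T = P by rewrite trmx_mul trmxK.
have PP : P *m P = q *: P.
  by rewrite /P mulmxA -(mulmxA u) uu mul_mx_scalar scalemxAl.
pose H : 'M[R]_n.+1 := 1%:M - (2 / q) *: P.
exists H.
  have -> : H^T = H by rewrite /H [LHS]raddfB /= trmx1 [X in _ - X]linearZ /= PT.
  rewrite /H.
  rewrite mulmxBl mul1mx mulmxBr mulmx1 -scalemxAl -scalemxAr PP !scalerA.
  have [q0|q0] := eqVneq q 0.
    by rewrite /P (u0 q0) !mul0mx !scaler0 !subr0.
  have -> : 2 / q * (2 / q) * q = 2 / q + 2 / q by field.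
  by rewrite scalerDl opprB addrK subrK.
have ve : v = e + u by rewrite addrC subrK.
have ee : e^T *m e = 1%:M.
  by rewrite trmx_delta mul_delta_mx; apply/matrixP => i j; rewrite !mxE !ord1 eqxx.
have uTe : u^T *m e = (- q / 2)%:M.
  have /matrixP/(_ 0 0) := v1.
  have -> : v^T = e^T + u^T by rewrite {1}ve [LHS]raddfD.
  rewrite {1}ve mulmxDl (mulmxDr e^T) (mulmxDr u^T) ee uu.
  have : (u^T *m e)^T = e^T *m u by rewrite trmx_mul trmxK.
  rewrite [u^T *m e]mx11_scalar tr_scalar_mx => <-; rewrite !mxE /= !mulr1n.
  set s := (X in _ + X) => h; congr (_%:M); move: h; rewrite /s => h.
  apply: (mulIf (_ : 2 != 0 :> R)); first by rewrite pnatr_eq0.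
  by rewrite divfK ?pnatr_eq0 //; lra.
rewrite -/e /H mulmxBl mul1mx -scalemxAl /P -mulmxA uTe mul_mx_scalar scalerA ve.
have [q0|q0] := eqVneq q 0; first by rewrite (u0 q0) scaler0 subr0 addr0.
have -> : 2 / q * (- q / 2) = -1 by field; rewrite q0.
by rewrite scaleN1r opprK.
Qed.

Lemma char_poly_conj (R : comNzRingType) n (A H : 'M[R]_n) :
  H^T *m H = 1%:M -> char_poly (H^T *m A *m H) = char_poly A.
Proof.
move=> HH; rewrite /char_poly.
have E : map_mx polyC H^T *m map_mx polyC H = 1%:M.
  by rewrite -map_mxM HH map_mx1.
have -> : char_poly_mx (H^T *m A *m H)
    = map_mx polyC H^T *m char_poly_mx A *m map_mx polyC H.
  rewrite /char_poly_mx mulmxBr mulmxBl -!map_mxM; congr (_ - _).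
  by rewrite mul_mx_scalar -scalemxAl E scale_scalar_mx mulr1.
by rewrite !det_mulmx mulrAC -det_mulmx E det1 mul1r.
Qed.

Lemma unit_eigenvector (R : rcfType) n (A : 'M[R]_n) (a : R) :
  A^T = A -> root (char_poly A) a ->
  exists2 v : 'cV[R]_n, v^T *m v = 1%:M & A *m v = a *: v.
Proof.
move=> AT; rewrite -eigenvalue_root_char => /eigenvalueP [r rA r0].
pose q := \sum_i r 0 i ^+ 2.
have q0 : 0 < q.
  rewrite lt_def sumr_ge0 ?andbT => [|i _]; last exact: sqr_ge0.
  apply: contraNneq r0 => /eqP; rewrite psumr_eq0 => [/allP h|i _]; last exact: sqr_ge0.
  apply/eqP/rowP => i; rewrite mxE.
  by have /(_ i (mem_index_enum _)) := h; rewrite sqrf_eq0 => /eqP.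
exists ((Num.sqrt q)^-1 *: r^T).
  rewrite mul_trmx_col; congr (_%:M).
  under eq_bigr => i _ do rewrite !mxE mulrACA -expr2.
  rewrite -mulr_sumr exprVn sqr_sqrtr ?ltW // /q.
  by rewrite mulVf // gt_eqF.
by rewrite -scalemxAr -{1}AT -trmx_mul rA linearZ /= scalerA mulrC -scalerA.
Qed.

(** Deflation: a reflection sending e_0 to a unit eigenvector conjugates A to a
    block diagonal matrix, whose lower block is symmetric with the remaining
    factors of the characteristic polynomial.  As the eigenvalues are handed over
    by the factorization one at a time, they appear on the diagonal in the
    prescribed order. *)
Lemma symmetric_orthodiag (R : rcfType) n (A : 'M[R]_n) (lam : nat -> R) :
  A^T = A -> char_poly A = \prod_(i < n) ('X - (lam i)%:P) ->
  exists2 U : 'M[R]_n, U^T *m U = 1%:M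
    & U^T *m A *m U = diag_mx (\row_(i < n) lam i).
Proof.
elim: n => [|n IH] in A lam *.
  by move=> _ _; exists 1%:M; apply/matrixP => -[].
move=> AT; rewrite big_ord_recl /= => hA.
have [|v v1 vA] := @unit_eigenvector _ _ A (lam 0%N) AT.
  by rewrite hA rootM root_XsubC eqxx.
have [H HH Hv] := householder v1.
have [B BE] : exists B : 'M_(1 + n), B = H^T *m A *m H by exists (H^T *m A *m H).
have BT : B^T = B by rewrite BE !trmx_mul trmxK AT mulmxA.
have Be : B *m delta_mx 0 0 = lam 0%N *: (delta_mx 0 0 : 'cV[R]_(1 + n)).
  rewrite BE -!mulmxA (Hv : H *m (delta_mx 0 0 : 'cV_n.+1) = v).
  by rewrite vA -scalemxAr -Hv mulmxA HH mul1mx.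
have B0 (i j : 'I_(1 + n)) : val j = 0%N -> B i j = lam 0%N * (val i == 0%N)%:R.
  move=> j0; have -> : j = (0 : 'I_n.+1) by apply: val_inj.
  by have /matrixP/(_ i 0) := Be; rewrite -colE !mxE eqxx andbT.
have Bblock : B = block_mx (lam 0%N)%:M 0 0 (drsubmx B).
  rewrite -[LHS]submxK.
  have ul : ulsubmx B = (lam 0%N)%:M.
    rewrite [LHS]mx11_scalar !mxE; congr (_%:M).
    by rewrite B0 //= mulr1.
  have dl : dlsubmx B = 0.
    apply/matrixP => i j; rewrite !mxE (ord1 j).
    by rewrite B0 //= mulr0.
  have ur : ursubmx B = 0.
    by apply: trmx_inj; rewrite trmx_ursub BT dl trmx0.
  by rewrite ul dl ur.
have [||V VV VB] := IH (drsubmx B) (fun i => lam i.+1).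
- by rewrite trmx_drsub BT.
- have charB : char_poly B = ('X - (lam 0%N)%:P) * char_poly (drsubmx B).
    rewrite [in LHS]Bblock /char_poly char_block_diag_mx det_ublock.
    by rewrite det_mx11 !mxE !mulr1n.
  have : char_poly B = char_poly A by rewrite BE char_poly_conj.
  by rewrite charB hA => /mulfI -> //; rewrite polyXsubC_eq0.
pose V1 : 'M_(1 + n) := block_mx 1%:M 0 0 V.
have V1T : V1^T = block_mx 1%:M 0 0 V^T by rewrite tr_block_mx !trmx0 trmx1.
have V11 : V1^T *m V1 = 1%:M.
  rewrite V1T /V1 mulmx_block !mulmx0 !mul0mx !mul1mx !addr0 !add0r VV.
  by rewrite -scalar_mx_block.
have V1B : V1^T *m B *m V1 = diag_mx (\row_i lam i).
  have -> : \row_i lam i = row_mx (lam 0%N)%:M (\row_i lam i.+1) :> 'rV_(1 + n).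
    apply/matrixP => i j; rewrite !mxE (ord1 i); case: splitP => k hk.
      by rewrite (ord1 k) !mxE eqxx mulr1n hk (ord1 k).
    by rewrite mxE hk.
  rewrite diag_mx_row Bblock V1T /V1 !mulmx_block !mulmx0 !mul0mx !mul1mx.
  rewrite !addr0 !add0r ?mul0mx mulmx1 VB; congr block_mx.
  by apply/matrixP => i j; rewrite !mxE !ord1.
exists (H *m V1).
  by rewrite trmx_mul mulmxA -(mulmxA _ _ H) HH mulmx1 V11.
by rewrite trmx_mul !mulmxA -(mulmxA _ H^T) -(mulmxA V1^T) -BE V1B.
Qed.

(** * Taylor expansion of the objective *)

Lemma frobenius_sq (R : realType) m k (X : 'M[R]_(m, k)) :
  frobenius X ^+ 2 = \tr (X^T *m X).
Proof.
rewrite /frobenius sqr_sqrtr; last first.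
  by apply: sumr_ge0 => i _; apply: sumr_ge0 => j _; exact: sqr_ge0.
rewrite exchange_big; apply: eq_bigr => j _; rewrite mxE.
by apply: eq_bigr => i _; rewrite mxE expr2.
Qed.

Lemma frobenius_ge0 (R : realType) m k (X : 'M[R]_(m, k)) : 0 <= frobenius X.
Proof. exact: sqrtr_ge0. Qed.

Lemma trace_frob_expand (R : comNzRingType) p (S P N : 'M[R]_p) (t : R) :
  \tr ((S + t *: P + t ^+ 2 *: N) *m (S + t *: P + t ^+ 2 *: N)) =
  \tr (S *m S) + 2 * t * \tr (S *m P) + t ^+ 2 * (\tr (P *m P) + 2 * \tr (S *m N))
  + 2 * t ^+ 3 * \tr (P *m N) + t ^+ 4 * \tr (N *m N).
Proof.
rewrite !mulmxDl !mulmxDr -!scalemxAl -!scalemxAr !linearD /= !linearZ /=.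
rewrite (mxtrace_mulC P S) (mxtrace_mulC N S) (mxtrace_mulC N P).
by ring.
Qed.

Section Taylor.
Variables (R : realType) (n p : nat) (A : 'M[R]_n) (mu : R) (W : 'M[R]_p).
Hypotheses (AT : A^T = A) (WT : W^T = W).

Definition gradient (Y : 'M[R]_(n, p)) : 'M[R]_(n, p) :=
  A *m Y + mu *: (Y *m (Y^T *m Y - W)).

(** The objective is a quartic polynomial, so its expansion along a line is
    exact: first and second order optimality conditions can be read off its
    coefficients. *)
Lemma fmuW_taylor (Y Z : 'M[R]_(n, p)) (t : R) :
  let P := Y^T *m Z + Z^T *m Y in
  fmuW A mu W (Y + t *: Z) = fmuW A mu W Y + t * \tr (Z^T *m gradient Y)
    + t ^+ 2 * (\tr (Z^T *m Hess A mu W Y Z) / 2)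
    + t ^+ 3 * (mu / 2 * \tr (P *m (Z^T *m Z)))
    + t ^+ 4 * (mu / 4 * \tr (Z^T *m Z *m (Z^T *m Z))).
Proof.
move=> P; rewrite /fmuW !frobenius_sq.
pose S := Y^T *m Y - W; pose N := Z^T *m Z.
have ST : S^T = S by rewrite /S [LHS]raddfB /= WT trmx_mul trmxK.
have quad : \tr ((Y + t *: Z)^T *m A *m (Y + t *: Z)) =
    \tr (Y^T *m A *m Y) + 2 * t * \tr (Z^T *m A *m Y) + t ^+ 2 * \tr (Z^T *m A *m Z).
  have -> : (Y + t *: Z)^T = Y^T + t *: Z^T by rewrite [LHS]raddfD /= [X in _ + X]linearZ.
  rewrite !mulmxDl !mulmxDr -!scalemxAl -!scalemxAr !linearD /= !linearZ /=.
  have -> : \tr (Y^T *m A *m Z) = \tr (Z^T *m A *m Y).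
    by rewrite -mxtrace_tr !trmx_mul trmxK AT mulmxA.
  by ring.
have gram : (Y + t *: Z)^T *m (Y + t *: Z) - W = S + t *: P + t ^+ 2 *: N.
  have -> : (Y + t *: Z)^T = Y^T + t *: Z^T by rewrite [LHS]raddfD /= [X in _ + X]linearZ.
  rewrite !mulmxDl !mulmxDr -!scalemxAl -!scalemxAr /S /P /N.
  by apply/matrixP => i j; rewrite !mxE; ring.
have gramT : (S + t *: P + t ^+ 2 *: N)^T = S + t *: P + t ^+ 2 *: N.
  rewrite -gram [LHS]raddfB /= trmx_mul trmxK WT //.
have SP : \tr (S *m P) = 2 * \tr (Z^T *m Y *m S).
  rewrite /P mulmxDr linearD /=.
  have -> : \tr (S *m (Y^T *m Z)) = \tr (Z^T *m Y *m S).
    by rewrite -mxtrace_tr !trmx_mul trmxK ST.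
  by rewrite (mxtrace_mulC S); ring.
have PP : \tr (P *m P) = 2 * (\tr (Z^T *m Y *m (Z^T *m Y)) + \tr (Z^T *m Y *m (Y^T *m Z))).
  rewrite /P mulmxDr !mulmxDl !linearD /=.
  have -> : \tr (Y^T *m Z *m (Y^T *m Z)) = \tr (Z^T *m Y *m (Z^T *m Y)).
    by rewrite -mxtrace_tr !trmx_mul !trmxK.
  by rewrite (mxtrace_mulC (Y^T *m Z)); ring.
have SN : \tr (S *m N) = \tr (N *m (Y^T *m Y)) - \tr (N *m W).
  by rewrite mxtrace_mulC /S mulmxBr linearB.
have hess : \tr (Z^T *m Hess A mu W Y Z) = \tr (Z^T *m A *m Z)
    + mu * (\tr (N *m (Y^T *m Y)) + \tr (Z^T *m Y *m (Z^T *m Y))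
    + \tr (Z^T *m Y *m (Y^T *m Z)) - \tr (N *m W)).
  rewrite /Hess mulmxDr -scalemxAr mulmxBr !mulmxDr mxtraceD mxtraceZ.
  rewrite [\tr (_ - _)]raddfB /= !mxtraceD.
  by rewrite /N !mulmxA.
rewrite ST gram gramT trace_frob_expand quad SP PP SN hess.
rewrite /gradient -/S (mulmxDr Z^T) -scalemxAr mxtraceD mxtraceZ !mulmxA.
by field.
Qed.

End Taylor.

(** The lowest order term dominates near t = 0. *)
Lemma quartic_ge0 (R : realFieldType) (a b c d : R) :
  (forall t, 0 <= t * a + t ^+ 2 * b + t ^+ 3 * c + t ^+ 4 * d) -> a = 0 /\ 0 <= b.
Proof.
have key (x y z u : R) : 0 < u ->
    (forall t, 0 < t -> 0 <= x + t * y + t ^+ 2 * z + t ^+ 3 * u) -> 0 <= x.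
  move=> u0 h; rewrite leNgt; apply/negP => x0.
  (* At t = 1 / s <= 1 the higher terms are at most t * (|y| + |z| + u), and s
     is chosen so large that this stays below - x. *)
  pose s := 1 + (`|y| + `|z| + u) / - x.
  have q0 : 0 <= (`|y| + `|z| + u) / - x.
    by rewrite divr_ge0 ?addr_ge0 ?normr_ge0 ?oppr_ge0 ?(ltW u0) ?(ltW x0).
  have s1 : 1 <= s by rewrite /s lerDl.
  have s0 : 0 < s := lt_le_trans ltr01 s1.
  have := h s^-1; rewrite invr_gt0 => /(_ s0).
  have v1 : s^-1 <= 1 by rewrite invf_le1.
  have v0 : 0 < s^-1 by rewrite invr_gt0.
  have e : s^-1 * (`|y| + `|z| + u) = - x - s^-1 * (- x).
    have : s * - x = - x + (`|y| + `|z| + u).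
      by rewrite /s mulrDl mul1r divfK // oppr_eq0 lt_eqF.
    move=> h1; have -> : `|y| + `|z| + u = s * - x - - x by rewrite h1; ring.
    by rewrite mulrBr mulrA mulVf ?gt_eqF // mul1r.
  have : s^-1 * y <= s^-1 * `|y| by rewrite ler_pM2l // ler_norm.
  have : s^-1 ^+ 2 * z <= s^-1 * `|z|.
    apply: (le_trans (ler_wpM2l (sqr_ge0 _) (ler_norm z))).
    by rewrite ler_wpM2r // expr2 ler_piMl // ltW.
  have : s^-1 ^+ 3 * u <= s^-1 * u.
    by rewrite ler_pM2r // exprS ler_piMr ?(ltW v0) // exprn_ile1 // ltW.
  have : 0 < s^-1 * - x by rewrite mulr_gt0 // oppr_gt0.
  by move: e; lra.
have key' (x y z u : R) :
    (forall t, 0 < t -> 0 <= x + t * y + t ^+ 2 * z + t ^+ 3 * u) -> 0 <= x.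
  move=> h; apply: (@key x y z (`|u| + 1)); first by rewrite ltr_wpDl.
  move=> t t0; apply: le_trans (h t t0) _; rewrite lerD2l ler_pM2l ?exprn_gt0 //.
  by rewrite (le_trans (ler_norm u)) // lerDl.
move=> h.
have a0 : 0 <= a.
  apply: (@key' a b c d) => t t0.
  by rewrite -(pmulr_rge0 _ t0); have := h t; congr (_ <= _); ring.
have a1 : 0 <= - a.
  apply: (@key' (- a) b (- c) d) => t t0.
  by rewrite -(pmulr_rge0 _ t0); have := h (- t); congr (_ <= _); ring.
have a2 : a = 0 by lra.
split=> //; apply: (@key' b c d 0) => t t0.
rewrite -(pmulr_rge0 _ (exprn_gt0 2 t0)); have := h t; rewrite a2.
by congr (_ <= _); ring.
Qed.

(** A strictly increasing self-map satisfies i <= f i; conjugating by the order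
    reversal gives the opposite inequality. *)
Lemma ord_homo_lt_id n (f : 'I_n -> 'I_n) :
  {homo f : i j / (i < j)%N} -> f =1 id.
Proof.
move=> fm.
have ge (g : 'I_n -> 'I_n) : {homo g : i j / (i < j)%N} -> forall i : 'I_n, (i <= g i)%N.
  move=> gm [i]; elim: i => [//|i IH] lt_in.
  have lt_i : (i < n)%N := ltnW lt_in.
  by apply: leq_ltn_trans (IH lt_i) _; apply: gm.
move=> i; apply/val_inj/eqP; rewrite /= eqn_leq ge // andbT.
pose g (j : 'I_n) := rev_ord (f (rev_ord j)).
have gm : {homo g : a b / (a < b)%N}.
  move=> a b ab /=.
  have : (f (rev_ord b) < f (rev_ord a))%N.
    by apply: fm => /=; have := ltn_ord b; lia.
  by have := ltn_ord (f (rev_ord a)); lia.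
have := ge g gm (rev_ord i); rewrite /g rev_ordK /=.
by have := ltn_ord i; have := ltn_ord (f i); lia.
Qed.

(** * The Hessian in coordinates *)

Lemma trace_trmx_mul (R : comNzRingType) n p (Z X : 'M[R]_(n, p)) :
  \tr (Z^T *m X) = \sum_i \sum_j Z i j * X i j.
Proof.
rewrite exchange_big; apply: eq_bigr => j _; rewrite mxE.
by apply: eq_bigr => i _; rewrite mxE.
Qed.

Lemma trace_delta (R : comNzRingType) n p k i (X : 'M[R]_(n, p)) :
  \tr ((delta_mx k i)^T *m X) = X k i.
Proof.
rewrite trace_trmx_mul (bigD1 k) //= (bigD1 i) //= mxE !eqxx mul1r.
rewrite !big1 ?addr0 // => [a /negPf ak|a /negPf ai].
  by rewrite big1 // => b _; rewrite mxE ak mul0r.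
by rewrite mxE ai andbF mul0r.
Qed.

Lemma HessD (R : realType) n p (A : 'M[R]_n) mu (W : 'M[R]_p)
    (Y Z1 Z2 : 'M[R]_(n, p)) a b :
  Hess A mu W Y (a *: Z1 + b *: Z2) = a *: Hess A mu W Y Z1 + b *: Hess A mu W Y Z2.
Proof.
rewrite /Hess; have -> : (a *: Z1 + b *: Z2)^T = a *: Z1^T + b *: Z2^T.
  by rewrite [LHS]raddfD /= [X in X + _]linearZ [X in _ + X]linearZ.
rewrite !(mulmxDl, mulmxDr) -!(scalemxAl, scalemxAr).
by apply/matrixP => i j; rewrite !mxE; ring.
Qed.

Section Diagonal.
Variables (R : realType) (p m : nat) (lam w : nat -> R) (mu : R).
Let n := (p + m)%N.
Let D : 'M[R]_n := diag_mx (\row_(i < n) lam i.+1).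
Let W : 'M[R]_p := diagW p w.
Let q (Y Z : 'M[R]_(n, p)) := \tr (Z^T *m Hess D mu W Y Z).

Lemma hess_entry (Y Z : 'M[R]_(n, p)) k i :
  Hess D mu W Y Z k i = lam k.+1 * Z k i + mu * (\sum_a Z k a * (Y^T *m Y) a i
   + \sum_a Y k a * (Z^T *m Y) a i + \sum_a Y k a * (Y^T *m Z) a i - Z k i * w i.+1).
Proof.
by rewrite /Hess /D /W /diagW mul_diag_mx mul_mx_diag -!mulmxA !mxE.
Qed.

Lemma sum_indicator (I : finType) (j : I) (F : I -> R) :
  \sum_a (a == j)%:R * F a = F j.
Proof.
rewrite (bigD1 j) //= eqxx mul1r big1 ?addr0 // => a /negPf ->.
by rewrite mul0r.
Qed.

Lemma hess_delta (Y : 'M[R]_(n, p)) l j k i :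
  Hess D mu W Y (delta_mx l j) k i =
  (k == l)%:R * (i == j)%:R * (lam k.+1 - mu * w i.+1)
  + mu * ((k == l)%:R * (Y^T *m Y) j i + Y k j * Y l i
          + (i == j)%:R * \sum_a Y k a * Y l a).
Proof.
rewrite hess_entry.
have -> : \sum_a (delta_mx l j : 'M[R]_(n, p)) k a * (Y^T *m Y) a i
    = (k == l)%:R * (Y^T *m Y) j i.
  rewrite -(sum_indicator j (fun a => (Y^T *m Y) a i)) mulr_sumr; apply: eq_bigr => a _.
  by rewrite mxE mulrA -natrM mulnb.
have -> : \sum_a Y k a * ((delta_mx l j : 'M[R]_(n, p))^T *m Y) a i = Y k j * Y l i.
  rewrite -(sum_indicator j (fun a => Y k a * Y l i)); apply: eq_bigr => a _.
  rewrite mxE mulrCA; congr (_ * _); rewrite -(sum_indicator l (fun b => Y b i)).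
  rewrite mulr_sumr; apply: eq_bigr => b _; rewrite !mxE -mulnb natrM; ring.
have -> : \sum_a Y k a * (Y^T *m (delta_mx l j : 'M[R]_(n, p))) a i
    = (i == j)%:R * \sum_a Y k a * Y l a.
  rewrite mulr_sumr; apply: eq_bigr => a _; rewrite mulrCA; congr (_ * _).
  rewrite [LHS]mxE -(sum_indicator l (fun b => Y b a)) mulr_sumr; apply: eq_bigr => b _.
  by rewrite !mxE -mulnb natrM; ring.
by rewrite mxE -mulnb natrM; ring.
Qed.

Lemma hess_quad1 (Y : 'M[R]_(n, p)) k i :
  q Y (delta_mx k i) = lam k.+1 - mu * w i.+1
    + mu * ((Y^T *m Y) i i + Y k i ^+ 2 + \sum_a Y k a ^+ 2).
Proof.
rewrite /q trace_delta hess_delta !eqxx !mul1r expr2.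
by congr (_ + _ * (_ + _)); apply: eq_bigr => a _; rewrite expr2.
Qed.

Lemma hess_quad2 (Y : 'M[R]_(n, p)) k i l j (a b : R) :
  q Y (a *: delta_mx k i + b *: delta_mx l j) =
  a ^+ 2 * q Y (delta_mx k i) + b ^+ 2 * q Y (delta_mx l j)
  + a * b * (Hess D mu W Y (delta_mx l j) k i + Hess D mu W Y (delta_mx k i) l j).
Proof.
rewrite /q HessD.
move: (Hess D mu W Y (delta_mx k i)) (Hess D mu W Y (delta_mx l j)) => H1 H2.
rewrite [(_ + _)^T]raddfD /= [(a *: _)^T]linearZ [(b *: _)^T]linearZ /=.
rewrite mulmxDl !mulmxDr -!scalemxAl -!scalemxAr !mxtraceD !mxtraceZ !trace_delta.
by ring.
Qed.

(** * Shape of the minimizers *)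

Hypothesis mu_gt0 : 0 < mu.
Hypothesis lam_lt : forall i j, (i < j < n)%N -> (i < p)%N -> lam i.+1 < lam j.+1.
Hypothesis lam_lt_muw : forall i j, (i < p)%N -> (j < p)%N -> lam i.+1 < mu * w j.+1.
Hypothesis w_lt : forall i j, (i < j < p)%N -> w j.+1 < w i.+1.

Section Minimizer.
Variable Y : 'M[R]_(n, p).
Hypothesis Ymin : global_minimizer (fmuW D mu W) Y.
Local Notation G := (Y^T *m Y).

(** First and second order necessary conditions: along each line through Y the
    increment of the objective is a nonnegative quartic without constant term. *)
Lemma minimizer_stationary :
  gradient D mu W Y = 0 /\ forall Z, 0 <= q Y Z.
Proof.
have DT : D^T = D by rewrite tr_diag_mx.
have WT : W^T = W by rewrite tr_diag_mx.
have crit Z : \tr (Z^T *m gradient D mu W Y) = 0 /\ 0 <= q Y Z / 2.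
  apply: (@quartic_ge0 _ _ _ (mu / 2 * \tr ((Y^T *m Z + Z^T *m Y) *m (Z^T *m Z)))
    (mu / 4 * \tr (Z^T *m Z *m (Z^T *m Z)))) => t.
  have := Ymin (Y + t *: Z); rewrite (fmuW_taylor mu DT WT).
  by rewrite -!(addrA (fmuW D mu W Y)) lerDl.
split=> [|Z]; last by have [_] := crit Z; lra.
by apply/matrixP => k i; rewrite -trace_delta mxE; have [-> _] := crit (delta_mx k i).
Qed.

Lemma gram_entry i j : G i j = \sum_a Y a i * Y a j.
Proof. by rewrite mxE; apply: eq_bigr => a _; rewrite mxE. Qed.

Lemma gramC i j : G i j = G j i.
Proof. by rewrite !gram_entry; apply: eq_bigr => a _; rewrite mulrC. Qed.

Lemma w_neq (i j : 'I_p) : i != j -> w i.+1 != w j.+1.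
Proof.
rewrite -val_eqE /= neq_ltn => /orP [] ij; first rewrite eq_sym.
  by rewrite lt_eqF // w_lt // ij /=.
by rewrite lt_eqF // w_lt // ij /=.
Qed.

(** Stationarity gives Y^T D Y + mu G^2 = mu G W with G = Y^T Y.  The left-hand
    side is symmetric, hence G commutes with W, which has distinct entries. *)
Lemma minimizer_orthogonal i j : i != j -> G i j = 0.
Proof.
move=> ij; have [grad0 _] := minimizer_stationary.
pose K := Y^T *m D *m Y + mu *: (G *m G).
have KT : K^T = K.
  rewrite /K [LHS]raddfD /= [X in _ + X]linearZ /= !trmx_mul !trmxK tr_diag_mx.
  by rewrite !mulmxA.
have KE : K = mu *: (G *m W).
  have : Y^T *m gradient D mu W Y = 0 by rewrite grad0 mulmx0.
  rewrite /gradient mulmxDr -scalemxAr mulmxBr mulmxBr !mulmxA scalerBr addrA.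
  by move/eqP; rewrite subr_eq0 /K !mulmxA => /eqP.
have Kij a b : K a b = mu * (G a b * w b.+1).
  by rewrite KE mxE /W /diagW mul_mx_diag [in LHS]mxE [in X in _ * (_ * X)]mxE.
have : K i j = K j i by rewrite -{1}KT mxE.
rewrite !Kij (gramC j i) => /(mulfI (lt0r_neq0 mu_gt0)) /eqP.
rewrite -subr_eq0 -mulrBr mulf_eq0 subr_eq0 => /orP [/eqP //|].
by rewrite eq_sym => /eqP wij; have := w_neq ij; rewrite wij eqxx.
Qed.

(** With G diagonal, entry (k, j) of the stationarity equation reads
    (lam_k + mu (G_jj - w_j)) Y_kj = 0. *)
Lemma minimizer_eigencolumn k j :
  Y k j != 0 -> lam k.+1 = mu * (w j.+1 - G j j).
Proof.
have [/matrixP/(_ k j) + _] := minimizer_stationary.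
rewrite /gradient mulmxBr /D /W /diagW mul_diag_mx mul_mx_diag !mxE.
rewrite (bigD1 j) //= [X in _ + (_ * (_ + X - _))]big1 ?addr0.
  rewrite (_ : \sum_(a < n) _ = G j j); last by rewrite mxE.
  move=> h y0; apply: (mulIf y0); apply/eqP; rewrite -subr_eq0 -h; apply/eqP.
  by ring.
by move=> a aj; rewrite -/(G) minimizer_orthogonal ?mulr0 // eq_sym.
Qed.

(** All nonzero entries of a column belong to one eigenvalue of D, and
    lam_1, ..., lam_p are simple. *)
Lemma minimizer_column_support (k : 'I_p) i j :
  Y (lshift m k) j != 0 -> Y i j != 0 -> i = lshift m k.
Proof.
move=> /minimizer_eigencolumn + /minimizer_eigencolumn => <- /= ik.
apply/val_inj => /=; case: (ltngtP i k) => // ltik.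
  by have := @lam_lt i k; rewrite ltik ik ltxx (ltn_trans ltik (ltn_ord k));
     rewrite (leq_trans (ltn_ord k) (leq_addr _ _)) => /(_ isT isT).
by have := @lam_lt k i; rewrite ltik ik ltxx !ltn_ord => /(_ isT isT).
Qed.

Lemma gram_of_supported (k : 'I_p) i j :
  Y (lshift m k) j != 0 -> G i j = Y (lshift m k) i * Y (lshift m k) j.
Proof.
move=> kj; rewrite gram_entry (bigD1 (lshift m k)) //= big1 ?addr0 // => a ak.
have [->|aj] := eqVneq (Y a j) 0; first by rewrite mulr0.
by rewrite (minimizer_column_support kj aj) eqxx in ak.
Qed.

Lemma minimizer_row_support (k : 'I_p) i j :
  Y (lshift m k) i != 0 -> Y (lshift m k) j != 0 -> i = j.
Proof.
move=> ki kj; apply/eqP; apply: contraT => /minimizer_orthogonal.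
by rewrite (gram_of_supported _ kj) => /eqP; rewrite mulf_eq0 (negPf ki) (negPf kj).
Qed.

(** If row k <= p vanished, the second order condition in the direction e_k of
    column j would read lam_k >= mu (w_j - |y_j|^2).  Since lam_k < mu w_j, column j
    would be nonzero, with an eigenvalue at most lam_k, hence a multiple of one of
    e_1, ..., e_(k-1).  By orthogonality different columns use different vectors,
    so that p <= k - 1 < p. *)
Lemma minimizer_row_neq0 (k : 'I_p) : exists j, Y (lshift m k) j != 0.
Proof.
apply/existsP; apply: contraT; rewrite negb_exists => /forallP k0.
have {}k0 j : Y (lshift m k) j = 0 by apply/eqP; rewrite -[_ == _]negbK.
have [_ hess_ge0] := minimizer_stationary.
have column j : exists i : 'I_k, Y (lshift m (widen_ord (ltnW (ltn_ord k)) i)) j != 0.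
  have := hess_ge0 (delta_mx (lshift m k) j); rewrite hess_quad1 k0.
  rewrite (_ : \sum_a _ = 0); last by rewrite big1 // => a _; rewrite k0 expr0n.
  rewrite expr0n /= !addr0 => hk.
  have [Gj|Gj] := eqVneq (G j j) 0.
    have := lam_lt_muw (ltn_ord k) (ltn_ord j).
    by move: hk; rewrite Gj; lra.
  have [i yi] : exists i, Y i j != 0.
    apply/existsP; apply: contraNT Gj; rewrite negb_exists => /forallP h.
    rewrite gram_entry big1 // => a _; have := h a.
    by rewrite negbK => /eqP ->; rewrite mulr0.
  have ki : lam i.+1 <= lam k.+1.
    by have := minimizer_eigencolumn yi; lra.
  have ik : (i < k)%N.
    rewrite ltnNge leq_eqVlt; apply/negP => /orP [/eqP ik|ltki].
      have e : i = lshift m k by apply: val_inj.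
      by move: yi; rewrite e k0 eqxx.
    have := @lam_lt k i; rewrite ltki !ltn_ord => /(_ isT isT).
    by rewrite ltNge ki.
  exists (Ordinal ik); rewrite (_ : lshift _ _ = i) //; exact: val_inj.
have [f fP] := fin_all_exists column.
have f_inj : injective f.
  by move=> i j fij; apply: minimizer_row_support (fP i) _; rewrite fij; apply: fP.
have := leq_card f f_inj; rewrite !card_ord leqNgt.
by rewrite ltn_ord.
Qed.

(** Each e_k, k <= p, spans a column t k of Y.  If t reversed the order of k < l,
    then on the plane spanned by the elementary matrices (l, t k) and (k, t l) the
    Hessian would have determinant
    mu (w_(t k) - w_(t l)) (lam_l - lam_k) < 0.  So t is increasing, thus the
    identity. *)
Lemma minimizer_diagonal (j : 'I_p) : Y (lshift m j) j != 0.
Proof.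
have [t tP] := fin_all_exists minimizer_row_neq0.
suff t_homo : {homo t : k l / (k < l)%N}.
  by have := tP j; rewrite (ord_homo_lt_id t_homo).
move=> k l kl; rewrite ltnNge leq_eqVlt; apply/negP => /orP [/eqP tkl|lt_t].
  have e : t l = t k by apply: val_inj.
  have := tP l; rewrite e => /(minimizer_column_support (tP k)) /lshift_inj lk.
  by rewrite lk ltnn in kl.
have [_ hess_ge0] := minimizer_stationary.
pose k' := lshift m k; pose l' := lshift m l.
have yk0 : Y k' (t l) = 0.
  apply/eqP; apply: contraT => h.
  by rewrite (minimizer_row_support (tP k) h) ltnn in lt_t.
have yl0 : Y l' (t k) = 0.
  apply/eqP; apply: contraT => h.
  by rewrite (minimizer_row_support (tP l) h) ltnn in lt_t.
have row (a : 'I_p) : \sum_b Y (lshift m a) b ^+ 2 = Y (lshift m a) (t a) ^+ 2.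
  rewrite (bigD1 (t a)) //= big1 ?addr0 // => b bt; apply/eqP; rewrite sqrf_eq0.
  by apply: contraNT bt => h; rewrite (minimizer_row_support (tP a) h).
pose x := Y k' (t k); pose y := Y l' (t l).
have Gk : G (t k) (t k) = x * x by rewrite (gram_of_supported _ (tP k)).
have Gl : G (t l) (t l) = y * y by rewrite (gram_of_supported _ (tP l)).
have ek := minimizer_eigencolumn (tP k); have el := minimizer_eigencolumn (tP l).
rewrite Gk /= in ek; rewrite Gl /= in el.
have lw : lam k.+1 < lam l.+1.
  by apply: lam_lt => //; rewrite kl (leq_trans (ltn_ord l)) ?leq_addr.
have ww : w (t k).+1 < w (t l).+1 by apply: w_lt; rewrite lt_t ltn_ord.
have wk : lam k.+1 < mu * w (t l).+1 by apply: lam_lt_muw.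
have kl' : (k' == l') = false.
  by apply/negP => /eqP /lshift_inj e; rewrite e ltnn in kl.
have ttkl : (t k == t l) = false.
  by apply/negP => /eqP e; rewrite e ltnn in lt_t.
have form a b : 0 <= a ^+ 2 * (mu * w (t l).+1 - lam k.+1)
    + b ^+ 2 * (mu * w (t k).+1 - lam l.+1) + 2 * a * b * (mu * x * y).
  have := hess_ge0 (a *: delta_mx l' (t k) + b *: delta_mx k' (t l)).
  rewrite hess_quad2 !hess_quad1 !hess_delta !row -/k' -/l' -/x -/y yk0 yl0 Gk Gl.
  rewrite [l' == k']eq_sym kl' [t l == t k]eq_sym ttkl /= ek el.
  by congr (_ <= _); ring.
set al := mu * w (t l).+1 - lam k.+1 in form.
set be := mu * w (t k).+1 - lam l.+1 in form.
have al0 : 0 < al by rewrite subr_gt0.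
have : 0 <= al * (al * be - (mu * x * y) ^+ 2).
  (* For a form al a^2 + be b^2 + 2 ga a b, the vector (ga, - al) gives al times
     the determinant. *)
  have := form (mu * x * y) (- al); congr (_ <= _); ring.
rewrite pmulr_rge0 // => det_ge0.
have det : al * be - (mu * x * y) ^+ 2 = mu * (w (t k).+1 - w (t l).+1) * (lam l.+1 - lam k.+1).
  by rewrite /al /be ek el; ring.
have : 0 < mu * (w (t l).+1 - w (t k).+1) * (lam l.+1 - lam k.+1).
  by rewrite !mulr_gt0 ?subr_gt0.
by move: det_ge0; rewrite det; lra.
Qed.

Lemma minimizer_shape :
  exists2 c : 'I_p -> R, Y = col_mx (diag_mx (\row_j c j)) 0
    & forall j : 'I_p, mu * c j ^+ 2 = mu * w j.+1 - lam j.+1.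
Proof.
exists (fun j => Y (lshift m j) j) => [|j].
  have off k j : k != lshift m j -> Y k j = 0.
    move=> kj; apply/eqP; apply: contraNT kj => h; apply/eqP.
    exact: minimizer_column_support (minimizer_diagonal j) h.
  apply/matrixP => k j; case: (splitP k) => a ka.
    have -> : k = lshift m a by apply: val_inj.
    rewrite col_mxEu !mxE; have [->|aj] := eqVneq a j; first by rewrite mulr1n.
    by rewrite mulr0n off //; apply: contraNneq aj => /lshift_inj ->.
  have -> : k = rshift p a by apply: val_inj.
  by rewrite col_mxEd mxE off // eq_rlshift.
have := minimizer_eigencolumn (minimizer_diagonal j).
rewrite (gram_of_supported _ (minimizer_diagonal j)) /= => ->.
by rewrite expr2; ring.
Qed.

End Minimizer.
End Diagonal.

(** * Symmetric two by two matrices *)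

Lemma set_maxE (R : realType) (S : set R) x : S x -> ubound S x -> set_max S = x.
Proof.
move=> Sx ubx; apply: xget_unique => [//|y [Sy uby]].
by apply/eqP; rewrite eq_le ubx ?uby.
Qed.

Lemma set_minE (R : realType) (S : set R) x : S x -> lbound S x -> set_min S = x.
Proof.
move=> Sx lbx; apply: xget_unique => [//|y [Sy lby]].
by apply/eqP; rewrite eq_le lbx ?lby.
Qed.

Lemma det_mx22 (R : comNzRingType) (B : 'M[R]_(1 + 1)) :
  let l := lshift 1 0 in let r := rshift 1 0 in
  \det B = B l l * B r r - B l r * B r l.
Proof.
rewrite (expand_det_row _ (lshift 1 0)) big_split_ord !big_ord1 /cofactor !det_mx11.
rewrite !mxE /=.
have -> : lift (lshift 1 (0 : 'I_1)) (0 : 'I_1) = rshift 1 0 by apply: val_inj.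
have -> : lift (rshift 1 (0 : 'I_1)) (0 : 'I_1) = lshift 1 0 by apply: val_inj.
by rewrite expr0 expr1; ring.
Qed.

Lemma eigenvalue_sym2 (R : fieldType) (a b s x : R) :
  eigenvalue (block_mx a%:M s%:M s%:M b%:M : 'M[R]_(1 + 1)) x
  = ((x - a) * (x - b) == s ^+ 2).
Proof.
rewrite /eigenvalue /eigenspace kermx_eq0 row_free_unit unitmxE unitfE negbK.
have -> : block_mx a%:M s%:M s%:M b%:M - x%:M
    = block_mx (a - x)%:M s%:M s%:M (b - x)%:M :> 'M[R]_(1 + 1).
  rewrite scalar_mx_block opp_block_mx add_block_mx !subr0.
  by congr block_mx; rewrite raddfB.
rewrite det_mx22 block_mxEul block_mxEur block_mxEdl block_mxEdr !mxE /= !mulr1n.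
by rewrite -[RHS]subr_eq0; congr (_ == _); ring.
Qed.

(** Multiplying the difference of the two sides by L - a completes the square:
    the result is ((L - a) x - g y)^2. *)
Lemma quad2_root_le (R : realFieldType) (a b g L x y : R) :
  a <= L -> b <= L -> (L - a) * (L - b) = g ^+ 2 ->
  a * x ^+ 2 + b * y ^+ 2 + 2 * g * x * y <= L * (x ^+ 2 + y ^+ 2).
Proof.
move=> aL bL hL; have [La|La] := eqVneq (L - a) 0.
  have g0 : g = 0 by apply/eqP; rewrite -sqrf_eq0 -hL La mul0r.
  have : 0 <= (L - b) * y ^+ 2 by rewrite mulr_ge0 ?sqr_ge0 // subr_ge0.
  by move/eqP: La; rewrite subr_eq0 g0 => /eqP ->; lra.
have La0 : 0 < L - a by rewrite lt_def La subr_ge0.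
rewrite -subr_ge0 -(pmulr_rge0 _ La0).
have : 0 <= ((L - a) * x - g * y) ^+ 2 by exact: sqr_ge0.
congr (_ <= _); rewrite sqrrB !exprMn -hL; ring.
Qed.

(** The vector (g, L - a) is an eigenvector for L; it vanishes only if g = 0 and
    L = a, where (1, 0) is one. *)
Lemma quad2_root_attained (R : rcfType) (a b g L : R) :
  (L - a) * (L - b) = g ^+ 2 ->
  exists x y, x ^+ 2 + y ^+ 2 = 1 /\ a * x ^+ 2 + b * y ^+ 2 + 2 * g * x * y = L.
Proof.
move=> hL; pose r := Num.sqrt (g ^+ 2 + (L - a) ^+ 2).
have [r0|r0] := eqVneq r 0.
  have : g ^+ 2 + (L - a) ^+ 2 <= 0 by rewrite -sqrtr_eq0 -/r r0.
  have := sqr_ge0 g; have := sqr_ge0 (L - a) => h1 h2 h3.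
  have : (L - a) ^+ 2 == 0 by apply/eqP; lra.
  rewrite sqrf_eq0 subr_eq0 => /eqP ->.
  by exists 1, 0; rewrite expr1n expr0n /=; split; lra.
have rr : r ^+ 2 = g ^+ 2 + (L - a) ^+ 2.
  by rewrite sqr_sqrtr // addr_ge0 ?sqr_ge0.
exists (g / r), ((L - a) / r); split.
  by rewrite !exprMn -mulrDl -rr -exprMn divff // expr1n.
have -> : a * (g / r) ^+ 2 + b * ((L - a) / r) ^+ 2 + 2 * g * (g / r) * ((L - a) / r)
   = (a * g ^+ 2 + b * (L - a) ^+ 2 + 2 * g ^+ 2 * (L - a)) / r ^+ 2 by field.
apply: (mulIf (_ : r ^+ 2 != 0)); first by rewrite sqrf_eq0.
by rewrite divfK ?sqrf_eq0 // rr -hL; ring.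
Qed.

Lemma quad2_root_exists (R : rcfType) (a b g : R) :
  exists L, [/\ a <= L, b <= L & (L - a) * (L - b) = g ^+ 2].
Proof.
pose r := Num.sqrt ((a - b) ^+ 2 + 4 * g ^+ 2).
have rr : r ^+ 2 = (a - b) ^+ 2 + 4 * g ^+ 2.
  by rewrite sqr_sqrtr //; have := sqr_ge0 (a - b); have := sqr_ge0 g; lra.
have : `|a - b| <= r by rewrite -sqrtr_sqr ler_wsqrtr // lerDl mulr_ge0 ?sqr_ge0 ?ler0n.
rewrite ler_norml => /andP [h1 h2].
exists ((a + b + r) / 2); split; [lra|lra|].
have -> : ((a + b + r) / 2 - a) * ((a + b + r) / 2 - b) = (r ^+ 2 - (a - b) ^+ 2) / 4.
  by field.
by rewrite rr; field.
Qed.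

(** The form is given with an off-diagonal coefficient g that agrees with the
    matrix entry s up to sign only: the c_j are known up to sign, whereas M_ij has
    a square root. *)
Section SymmetricTwoByTwo.
Variables (R : realType) (a b s g : R).
Hypothesis sg : g ^+ 2 = s ^+ 2.
Let M : 'M[R]_2 := block_mx a%:M s%:M s%:M b%:M : 'M[R]_(1 + 1).
Let quad x y := a * x ^+ 2 + b * y ^+ 2 + 2 * g * x * y.

Lemma eigenvalue_sym2_sq x : eigenvalue M x = ((x - a) * (x - b) == g ^+ 2).
Proof. by rewrite sg -eigenvalue_sym2. Qed.

Lemma lambda_max_quad2 :
  (forall x y, quad x y <= lambda_max M * (x ^+ 2 + y ^+ 2)) /\
  exists x y, x ^+ 2 + y ^+ 2 = 1 /\ quad x y = lambda_max M.
Proof.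
have [L [aL bL hL]] := quad2_root_exists a b g.
have bnd x y : quad x y <= L * (x ^+ 2 + y ^+ 2) by exact: quad2_root_le.
rewrite /lambda_max (@set_maxE _ _ L); first by split; last exact: quad2_root_attained.
  by rewrite /= eigenvalue_sym2_sq hL.
move=> x /=; rewrite eigenvalue_sym2_sq => /eqP /quad2_root_attained [u [v [uv1 <-]]].
by have := bnd u v; rewrite uv1 mulr1.
Qed.

Lemma lambda_min_quad2 :
  (forall x y, lambda_min M * (x ^+ 2 + y ^+ 2) <= quad x y) /\
  exists x y, x ^+ 2 + y ^+ 2 = 1 /\ quad x y = lambda_min M.
Proof.
have [L [aL bL hL]] := quad2_root_exists (- a) (- b) (- g).
have hL' : (- L - a) * (- L - b) = g ^+ 2 by rewrite -(sqrrN g) -hL; ring.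
have bnd x y : - L * (x ^+ 2 + y ^+ 2) <= quad x y.
  by have := quad2_root_le x y aL bL hL; rewrite /quad; lra.
rewrite /lambda_min (@set_minE _ _ (- L)).
- by split; last exact: quad2_root_attained.
- by rewrite /= eigenvalue_sym2_sq hL'.
move=> x /=; rewrite eigenvalue_sym2_sq => /eqP /quad2_root_attained [u [v [uv1 <-]]].
by have := bnd u v; rewrite uv1 mulr1.
Qed.

End SymmetricTwoByTwo.

(** * The Hessian at a minimizer *)

(** The entries (i, j) and (j, i) are coupled, so a sum over all pairs has to be
    symmetrized before it can be bounded termwise. *)
Lemma sum_sym_ge0 (R : realFieldType) (I : finType) (F : I -> I -> R) :
  (forall i j, 0 <= F i j + F j i) -> 0 <= \sum_i \sum_j F i j.
Proof.
move=> F0; have : 0 <= \sum_i \sum_j (F i j + F j i).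
  by apply: sumr_ge0 => i _; apply: sumr_ge0.
under eq_bigr => i _ do rewrite big_split /=.
by rewrite big_split /= [X in _ + X]exchange_big /=; lra.
Qed.

Lemma trace_two_delta (R : comNzRingType) n p (k l : 'I_n) (i j : 'I_p) (a b : R) X :
  \tr ((a *: delta_mx k i + b *: delta_mx l j)^T *m X) = a * X k i + b * X l j.
Proof.
rewrite [(_ + _)^T]raddfD /= [(a *: _)^T]linearZ [(b *: _)^T]linearZ /=.
by rewrite mulmxDl -!scalemxAl mxtraceD !mxtraceZ !trace_delta.
Qed.

Lemma frobenius_eq1 (R : realType) n p (Z : 'M[R]_(n, p)) :
  \tr (Z^T *m Z) = 1 -> frobenius Z = 1.
Proof.
rewrite -frobenius_sq => /eqP; rewrite sqrf_eq1 => /orP [/eqP //|/eqP h].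
by have := frobenius_ge0 Z; rewrite h; lra.
Qed.

Section ShapedPoint.
Variables (R : realType) (p m : nat) (lam w : nat -> R) (mu : R) (c : 'I_p -> R).
Hypothesis cE : forall j : 'I_p, mu * c j ^+ 2 = mu * w j.+1 - lam j.+1.
Let D : 'M[R]_(p + m) := diag_mx (\row_i lam i.+1).
Let Y : 'M[R]_(p + m, p) := col_mx (diag_mx (\row_j c j)) 0.
Let H := Hess D mu (diagW p w) Y.
Let q Z := \tr (Z^T *m H Z).

(** The relation mu c_j^2 = mu w_j - lam_j turns the coefficient
    lam_k + mu c_i^2 + mu c_k^2 - mu w_i into mu w_k - lam_i. *)
Lemma hess_shaped_u Z (k i : 'I_p) : H Z (lshift m k) i =
  (mu * w k.+1 - lam i.+1) * Z (lshift m k) i + mu * c k * c i * Z (lshift m i) k.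
Proof.
have Yl a b : Y (lshift m a) b = (a == b)%:R * c b.
  by rewrite col_mxEu !mxE; case: eqVneq => [->|_]; rewrite ?mulr1n ?mul1r ?mul0r.
have Yr a b : Y (rshift p a) b = 0 by rewrite col_mxEd mxE.
have YtE (V : 'M[R]_(p + m, p)) a b : (Y^T *m V) a b = c a * V (lshift m a) b.
  rewrite mxE big_split_ord /= [X in _ + X]big1 ?addr0 => [|e _]; last first.
    by rewrite mxE Yr mul0r.
  by rewrite -(sum_indicator a (fun e => c a * V (lshift m e) b));
     apply: eq_bigr => e _; rewrite mxE Yl; case: eqVneq => [->|_] /=; ring.
rewrite /H hess_entry.
have -> : \sum_a Z (lshift m k) a * (Y^T *m Y) a i = c i ^+ 2 * Z (lshift m k) i.
  rewrite -(sum_indicator i (fun a => c i ^+ 2 * Z (lshift m k) a)).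
  by apply: eq_bigr => a _; rewrite YtE Yl; case: eqVneq => [->|_] /=; ring.
have -> : \sum_a Y (lshift m k) a * (Z^T *m Y) a i = c k * c i * Z (lshift m i) k.
  rewrite -(sum_indicator k (fun a => c a * c i * Z (lshift m i) a)).
  apply: eq_bigr => a _; rewrite Yl eq_sym.
  have -> : (Z^T *m Y) a i = (Y^T *m Z) i a.
    by rewrite -[Z^T *m Y]trmxK trmx_mul trmxK mxE.
  by rewrite YtE; ring.
have -> : \sum_a Y (lshift m k) a * (Y^T *m Z) a i = c k ^+ 2 * Z (lshift m k) i.
  rewrite -(sum_indicator k (fun a => c a ^+ 2 * Z (lshift m a) i)).
  by apply: eq_bigr => a _; rewrite Yl eq_sym YtE; ring.
have := cE i; have := cE k => /= ck ci.
rewrite (_ : _ + mu * _ = (lam k.+1 + (mu * c i ^+ 2) + (mu * c k ^+ 2) - mu * w i.+1)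
   * Z (lshift m k) i + mu * c k * c i * Z (lshift m i) k); last by ring.
by rewrite ck ci; ring.
Qed.

Lemma hess_shaped_d Z (k : 'I_m) (i : 'I_p) : H Z (rshift p k) i =
  (lam (p + k).+1 - lam i.+1) * Z (rshift p k) i.
Proof.
have Yr b : Y (rshift p k) b = 0 by rewrite col_mxEd mxE.
rewrite /H hess_entry.
have -> : \sum_a Y (rshift p k) a * (Z^T *m Y) a i = 0.
  by rewrite big1 // => a _; rewrite Yr mul0r.
have -> : \sum_a Y (rshift p k) a * (Y^T *m Z) a i = 0.
  by rewrite big1 // => a _; rewrite Yr mul0r.
have -> : \sum_a Z (rshift p k) a * (Y^T *m Y) a i = c i ^+ 2 * Z (rshift p k) i.
  rewrite -(sum_indicator i (fun a => c i ^+ 2 * Z (rshift p k) a)).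
  apply: eq_bigr => a _; rewrite /Y tr_col_mx mul_row_col trmx0 mul0mx addr0.
  rewrite tr_diag_mx mul_diag_mx !mxE eq_sym.
  by case: eqVneq => [->|_]; rewrite ?mulr1n ?mulr0n; ring.
have := cE i => /= ci.
rewrite (_ : _ + mu * _ = (lam (p + k).+1 + mu * c i ^+ 2 - mu * w i.+1)
  * Z (rshift p k) i); last by rewrite /=; ring.
by rewrite ci; ring.
Qed.

Definition pair_form (i j : 'I_p) (x y : R) :=
  (mu * w i.+1 - lam j.+1) * x ^+ 2 + (mu * w j.+1 - lam i.+1) * y ^+ 2
  + 2 * (mu * c i * c j) * x * y.

(** The scalar s is 1 for upper and -1 for lower bounds, so that both follow
    from the same decomposition of the form. *)
Lemma hess_shaped_le (s M : R) :
  (forall (k : 'I_m) (i : 'I_p), s * (lam (p + k).+1 - lam i.+1) <= M) ->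
  (forall i : 'I_p, s * (2 * (mu * w i.+1 - lam i.+1)) <= M) ->
  (forall (i j : 'I_p) x y, (i < j)%N ->
     s * pair_form i j x y <= M * (x ^+ 2 + y ^+ 2)) ->
  forall Z, s * q Z <= M * frobenius Z ^+ 2.
Proof.
move=> hd hdiag hpair Z; rewrite frobenius_sq /q !trace_trmx_mul !big_split_ord /=.
set Zu := \sum_i _; set Zd := \sum_i _; set Hu := \sum_i _; set Hd := \sum_i _.
have : 0 <= M * Hd - s * Zd.
  rewrite !mulr_sumr -sumrB; apply: sumr_ge0 => k _.
  rewrite !mulr_sumr -sumrB; apply: sumr_ge0 => i _.
  rewrite hess_shaped_d (_ : _ - _ = (M - s * (lam (p + k).+1 - lam i.+1))
    * Z (rshift p k) i ^+ 2); last by ring.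
  by rewrite mulr_ge0 ?sqr_ge0 // subr_ge0.
have : 0 <= M * Hu - s * Zu.
  rewrite !mulr_sumr -sumrB.
  under eq_bigr => i _ do rewrite !mulr_sumr -sumrB.
  apply: sum_sym_ge0 => i j; rewrite !hess_shaped_u.
  have pairE (u v : 'I_p) : (u < v)%N -> 0 <=
      M * (Z (lshift m u) v ^+ 2 + Z (lshift m v) u ^+ 2)
      - s * pair_form u v (Z (lshift m u) v) (Z (lshift m v) u).
    by move=> uv; rewrite subr_ge0 hpair.
  case: (ltngtP i j) => [/pairE|/pairE|/val_inj <-].
  - by rewrite /pair_form; congr (_ <= _); ring.
  - by rewrite /pair_form; congr (_ <= _); ring.
  have : 0 <= 2 * (M - s * (mu * w i.+1 - lam i.+1 + mu * c i ^+ 2))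
      * Z (lshift m i) i ^+ 2.
    have := hdiag i; have := cE i => /= -> hi.
    by rewrite mulr_ge0 ?sqr_ge0 // mulr_ge0 // subr_ge0; move: hi; lra.
  by congr (_ <= _); ring.
by lra.
Qed.

Let attained (v : R) := exists2 Z, frobenius Z = 1 & q Z = v.

Lemma attained_gap (k : 'I_m) (i : 'I_p) : attained (lam (p + k).+1 - lam i.+1).
Proof.
exists (delta_mx (rshift p k) i); first by rewrite frobenius_eq1 // trace_delta mxE !eqxx.
by rewrite /q trace_delta hess_shaped_d mxE !eqxx mulr1.
Qed.

Lemma attained_diag (i : 'I_p) : attained (2 * (mu * w i.+1 - lam i.+1)).
Proof.
exists (delta_mx (lshift m i) i); first by rewrite frobenius_eq1 // trace_delta mxE !eqxx.
rewrite /q trace_delta hess_shaped_u mxE !eqxx !mulr1.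
by have := cE i => /= <-; ring.
Qed.

Lemma attained_pair (i j : 'I_p) (x y : R) : (i < j)%N ->
  x ^+ 2 + y ^+ 2 = 1 -> attained (pair_form i j x y).
Proof.
move=> ij xy1; have ji : (j == i) = false by apply: gtn_eqF.
have ij' : (i == j) = false by apply: ltn_eqF.
exists (x *: delta_mx (lshift m i) j + y *: delta_mx (lshift m j) i).
  apply: frobenius_eq1; rewrite trace_two_delta !mxE !eq_lshift !eqxx ji ij' /= -[RHS]xy1.
  by ring.
rewrite /q trace_two_delta !hess_shaped_u !mxE !eq_lshift !eqxx ji ij' /=.
by rewrite /pair_form; ring.
Qed.

Lemma pair_coupling (i j : 'I_p) : (mu * c i * c j) ^+ 2 =
  Num.sqrt ((mu * w i.+1 - lam i.+1) * (mu * w j.+1 - lam j.+1)) ^+ 2.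
Proof.
have e : (mu * c i * c j) ^+ 2 = (mu * w i.+1 - lam i.+1) * (mu * w j.+1 - lam j.+1).
  by have := cE i; have := cE j => /= <- <-; ring.
by rewrite sqr_sqrtr -e // sqr_ge0.
Qed.

Lemma lambda_max_pair (i j : 'I_p) :
  let L := lambda_max (Mpair mu lam w i.+1 j.+1) in
  (forall x y, pair_form i j x y <= L * (x ^+ 2 + y ^+ 2)) /\
  ((i < j)%N -> attained L).
Proof.
have [le [x [y [xy1 eL]]]] := lambda_max_quad2 (mu * w i.+1 - lam j.+1)
  (mu * w j.+1 - lam i.+1) (pair_coupling i j).
by split=> [//|ij]; rewrite -[lambda_max _]eL; exact: attained_pair.
Qed.

Lemma lambda_min_pair (i j : 'I_p) :
  let L := lambda_min (Mpair mu lam w i.+1 j.+1) in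
  (forall x y, L * (x ^+ 2 + y ^+ 2) <= pair_form i j x y) /\
  ((i < j)%N -> attained L).
Proof.
have [le [x [y [xy1 eL]]]] := lambda_min_quad2 (mu * w i.+1 - lam j.+1)
  (mu * w j.+1 - lam i.+1) (pair_coupling i j).
by split=> [//|ij]; rewrite -[lambda_min _]eL; exact: attained_pair.
Qed.

(** Every number entering the maximum is a value of the form, hence so is the
    maximum itself; and it dominates the form because it dominates each block. *)
Lemma quad_set_max (d e : R) :
  attained d -> (forall (k : 'I_m) (i : 'I_p), lam (p + k).+1 - lam i.+1 <= d) ->
  attained e -> (forall i : 'I_p, 2 * (mu * w i.+1 - lam i.+1) <= e) ->
  set_max [set \tr (Z^T *m H Z) | Z in [set Z | frobenius Z = 1]] =
  max_pairs p (Num.max d e) (fun i j => lambda_max (Mpair mu lam w i j)).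
Proof.
move=> ad led ae lee; rewrite /max_pairs; set M := \big[_/_]_(_ | _) _.
have att_max u v : attained u -> attained v -> attained (Num.max u v).
  by rewrite maxEle; case: ifP.
have id_le : Num.max d e <= M by exact: bigmax_ge_id.
have [dM eM] : d <= M /\ e <= M by move: id_le; rewrite ge_max => /andP.
apply: set_maxE.
  have [Z Z1 qZ] : attained M; last by exists Z.
  apply: (big_ind attained) => [||ij ltij]; [exact: att_max|exact: att_max|].
  exact: (lambda_max_pair ij.1 ij.2).2.
move=> _ [Z /= Z1 <-]; rewrite -[_ <= _]/(q Z <= M).
have := @hess_shaped_le 1 M _ _ _ Z; rewrite Z1 expr1n mulr1 mul1r; apply.
- by move=> k i; rewrite mul1r; exact: le_trans (led k i) dM.
- by move=> i; rewrite mul1r; exact: le_trans (lee i) eM.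
move=> i j x y ij; rewrite mul1r; apply: le_trans ((lambda_max_pair i j).1 x y) _.
rewrite ler_wpM2r ?addr_ge0 ?sqr_ge0 //.
by rewrite /M (@le_bigmax_cond _ _ _ _ (i, j)).
Qed.

Lemma quad_set_min (d e : R) :
  attained d -> (forall (k : 'I_m) (i : 'I_p), d <= lam (p + k).+1 - lam i.+1) ->
  attained e -> (forall i : 'I_p, e <= 2 * (mu * w i.+1 - lam i.+1)) ->
  set_min [set \tr (Z^T *m H Z) | Z in [set Z | frobenius Z = 1]] =
  min_pairs p (Num.min d e) (fun i j => lambda_min (Mpair mu lam w i j)).
Proof.
move=> ad led ae lee; rewrite /min_pairs; set M := \big[_/_]_(_ | _) _.
have att_min u v : attained u -> attained v -> attained (Num.min u v).
  by rewrite minEle; case: ifP.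
have id_le : M <= Num.min d e by exact: bigmin_le_id.
have [dM eM] : M <= d /\ M <= e by move: id_le; rewrite le_min => /andP.
apply: set_minE.
  have [Z Z1 qZ] : attained M; last by exists Z.
  apply: (big_ind attained) => [||ij ltij]; [exact: att_min|exact: att_min|].
  exact: (lambda_min_pair ij.1 ij.2).2.
move=> _ [Z /= Z1 <-]; rewrite -[_ <= _]/(M <= q Z) -lerN2.
have := @hess_shaped_le (-1) (- M) _ _ _ Z; rewrite Z1 expr1n mulr1 mulN1r; apply.
- by move=> k i; rewrite mulN1r lerN2; exact: le_trans dM (led k i).
- by move=> i; rewrite mulN1r lerN2; exact: le_trans eM (lee i).
move=> i j x y ij; rewrite mulN1r mulNr lerN2; apply: le_trans ((lambda_min_pair i j).1 x y).
rewrite ler_wpM2r ?addr_ge0 ?sqr_ge0 //.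
by rewrite /M (@bigmin_le_cond _ _ _ _ (i, j)).
Qed.

End ShapedPoint.

(** * Rotation to the eigenbasis and conclusion *)

Lemma fmuW_rotate (R : realType) n p (A U : 'M[R]_n) mu (W : 'M[R]_p) (X : 'M[R]_(n, p)) :
  U^T *m U = 1%:M -> fmuW A mu W (U *m X) = fmuW (U^T *m A *m U) mu W X.
Proof.
move=> UU; rewrite /fmuW trmx_mul.
by rewrite !mulmxA -(mulmxA _ U^T U) UU mulmx1.
Qed.

Lemma hess_rotate (R : realType) n p (A U : 'M[R]_n) mu (W : 'M[R]_p)
    (Y Z : 'M[R]_(n, p)) :
  U^T *m U = 1%:M ->
  \tr ((U *m Z)^T *m Hess A mu W (U *m Y) (U *m Z)) =
  \tr (Z^T *m Hess (U^T *m A *m U) mu W Y Z).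
Proof.
move=> UU; rewrite trmx_mul -(mulmxA Z^T); congr (\tr (_ *m _)).
rewrite /Hess mulmxDr -scalemxAr mulmxBr !mulmxDr !trmx_mul !mulmxA UU !mul1mx.
by rewrite -!(mulmxA _ U^T U) UU !mulmx1.
Qed.

Theorem theorem2p4 (R : realType) (n p : nat) (hp : (1 <= p)%N) (hpn : (p < n)%N)
  (A : 'M[R]_n) (hA : A^T = A)
  (lam : nat -> R) (hlam : spectrum A lam)
  (hlam_lt : forall i : nat, (1 <= i <= p)%N -> lam i < lam i.+1)
  (hlam_le : forall i : nat, (p < i < n)%N -> lam i <= lam i.+1)
  (mu : R) (hmu : 0 < mu)
  (w : nat -> R)
  (hw_lt : forall i : nat, (1 <= i < p)%N -> w i.+1 < w i)
  (hw_p : lam p / mu < w p)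
  (Xs : 'M[R]_(n, p)) (hXs : global_minimizer (fmuW A mu (diagW p w)) Xs) :
  kappa (Hess A mu (diagW p w) Xs) =
    max_pairs p (Num.max (lam n - lam 1%N) (2 * (mu * w 1%N - lam 1%N)))
      (fun i j => lambda_max (Mpair mu lam w i j))
    / min_pairs p (Num.min (lam p.+1 - lam p) (2 * (mu * w p - lam p)))
      (fun i j => lambda_min (Mpair mu lam w i j)).
Proof.
have lam_le i j : (i <= j < n)%N -> lam i.+1 <= lam j.+1.
  move=> /andP [ij jn]; elim: j => [|j IH] in ij jn *.
    by move: ij; rewrite leqn0 => /eqP ->.
  move: ij; rewrite leq_eqVlt => /orP [/eqP -> //|ij].
  apply: le_trans (IH ij (ltnW jn)) _; have [jp|jp] := leqP j.+1 p.
    by apply/ltW/hlam_lt.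
  by apply: hlam_le; rewrite jp.
have lam_lt i j : (i < j < n)%N -> (i < p)%N -> lam i.+1 < lam j.+1.
  move=> /andP [ij jn] ip; apply: lt_le_trans (hlam_lt i.+1 _) _; first by rewrite ip.
  by apply: lam_le; rewrite ij.
have w_le i j : (i <= j < p)%N -> w j.+1 <= w i.+1.
  move=> /andP [ij jp]; elim: j => [|j IH] in ij jp *.
    by move: ij; rewrite leqn0 => /eqP ->.
  move: ij; rewrite leq_eqVlt => /orP [/eqP -> //|ij].
  by apply: le_trans (IH ij (ltnW jp)); apply/ltW/hw_lt.
have w_lt i j : (i < j < p)%N -> w j.+1 < w i.+1.
  move=> /andP [ij jp]; apply: le_lt_trans (hw_lt i.+1 _); last by rewrite (leq_ltn_trans ij).
  by apply: w_le; rewrite ij.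
have lam_w i j : (i < p)%N -> (j < p)%N -> lam i.+1 < mu * w j.+1.
  move=> ip jp; have p1 : p.-1.+1 = p by rewrite prednK.
  have h1 : lam i.+1 <= lam p by rewrite -p1; apply: lam_le; lia.
  have h2 : w p <= w j.+1 by rewrite -p1; apply: w_le; lia.
  apply: le_lt_trans h1 _; rewrite mulrC -ltr_pdivrMr //.
  exact: lt_le_trans hw_p h2.
have [U UU UA] : exists2 U : 'M[R]_n, U^T *m U = 1%:M
    & U^T *m A *m U = diag_mx (\row_(i < n) lam i.+1).
  apply: (@symmetric_orthodiag _ _ _ (fun i => lam i.+1)) => //.
  by rewrite hlam big_add1 /= big_mkord.
have UU' : U *m U^T = 1%:M by apply: mulmx1C.
have XE : Xs = U *m (U^T *m Xs) by rewrite mulmxA UU' mul1mx.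
rewrite XE in hXs *; move: (U^T *m Xs) => {XE Xs} Y in hXs *.
have Ymin : global_minimizer (fmuW (U^T *m A *m U) mu (diagW p w)) Y.
  by move=> V; rewrite -!fmuW_rotate //; exact: hXs.
have QE : [set \tr (Z^T *m Hess A mu (diagW p w) (U *m Y) Z) | Z in [set Z | frobenius Z = 1]]
   = [set \tr (Z^T *m Hess (U^T *m A *m U) mu (diagW p w) Y Z) | Z in [set Z | frobenius Z = 1]].
  have isom (V : 'M[R]_(n, p)) : frobenius V = 1 -> frobenius (U *m V) = 1.
    move=> V1; apply: frobenius_eq1.
    by rewrite trmx_mul !mulmxA -(mulmxA _ U^T) UU mulmx1 -frobenius_sq V1 expr1n.
  apply/seteqP; split=> _ [Z /= Z1 <-].
    have ZE : Z = U *m (U^T *m Z) by rewrite mulmxA UU' mul1mx.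
    exists (U^T *m Z); last by rewrite -(hess_rotate A mu _ Y (U^T *m Z) UU) -ZE.
    apply: frobenius_eq1.
    by rewrite trmx_mul trmxK !mulmxA -(mulmxA _ U) UU' mulmx1 -frobenius_sq Z1 expr1n.
  by exists (U *m Z); [exact: isom|rewrite hess_rotate].
rewrite /kappa QE UA {QE hXs}; rewrite UA {UA UU UU'} in Ymin; move: Y Ymin.
have [p' ep] : exists p', p = p'.+1 by exists p.-1; rewrite prednK.
have [m en] : exists m, n = (p + m.+1)%N by exists (n - p).-1; lia.
subst n p; set p := p'.+1 in lam_lt w_lt lam_w w_le *.
have pE : p = p'.+1 by [].
move=> Y /(minimizer_shape hmu lam_lt lam_w w_lt) [c -> cE].
(* The largest and smallest gaps lam_i - lam_j, i > p >= j, are at the corners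
   (n, 1) and (p + 1, p); the diagonal values are extreme at 1 and p. *)
have lam_n : lam (p + m.+1)%N = lam (p + (ord_max : 'I_m.+1))%N.+1 by rewrite addnS.
have lam_p1 : lam p.+1 = lam (p + (ord0 : 'I_m.+1))%N.+1 by rewrite addn0.
have lam_ord (i : 'I_p) : lam 1%N <= lam i.+1 <= lam p.
  by have ip := ltn_ord i; rewrite !lam_le //; lia.
have lam_p_ord (k : 'I_m.+1) : lam p.+1 <= lam (p + k)%N.+1 <= lam (p + m.+1)%N.
  by have km := ltn_ord k; rewrite addnS !lam_le //; lia.
have w_ord (i : 'I_p) : w p <= w i.+1 <= w 1%N.
  by have ip := ltn_ord i; rewrite !w_le //; lia.
congr (_ / _).
  apply: (quad_set_max cE).
  - by rewrite lam_n; exact: (attained_gap cE _ (ord0 : 'I_p)).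
  - by move=> k i; rewrite lerB //; [case/andP: (lam_p_ord k)|case/andP: (lam_ord i)].
  - exact: (attained_diag _ cE (ord0 : 'I_p)).
  - move=> i; have [/andP [l1 _] /andP [_ w1]] := (lam_ord i, w_ord i).
    by rewrite ler_pM2l // lerB // ler_pM2l.
apply: (quad_set_min cE).
- by rewrite lam_p1; exact: (attained_gap cE _ (ord_max : 'I_p)).
- by move=> k i; rewrite lerB //; [case/andP: (lam_p_ord k)|case/andP: (lam_ord i)].
- exact: (attained_diag _ cE (ord_max : 'I_p)).
- move=> i; have [/andP [_ l1] /andP [w1 _]] := (lam_ord i, w_ord i).
  by rewrite ler_pM2l // lerB // ler_pM2l.
Qed.
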